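(* Let $V, V'$ be finite-dimensional real vector spaces with inner product, $X, X'$ metric spaces, and let $\sigma\colon V\to X$ and $\sigma'\colon V'\to X'$ be submetries. Let $\varphi\colon X\to X'$ be an isometry, and $S\subset X$ a closed subset. Then $\sigma^{-1}(S)$ is convex if and only if $(\sigma')^{-1}(\varphi(S))$ is convex. Thus $\varphi$ induces a bijection between closed convex $\sigma$-saturated subsets of $V$ and closed convex $\sigma'$-saturated subsets of $V'$, given by $\sigma^{-1}(S)\mapsto(\sigma')^{-1}(\varphi(S))$.
   Context: A submetry is a map $\sigma\colon Y\to X$ between metric spaces that maps closed balls to closed balls of the same radius, i.e. the image of the closed ball of radius $r$ around $y$ is the closed ball of radius $r$ around $\sigma(y)$. The vector spaces $V,V'$ carry the Euclidean metrics associated with their inner products. A subset of $V$ is $\sigma$-saturated if it is a union of fibers of $\sigma$, that is, if it is the inverse image under $\sigma$ of a subset of $X$; similarly for $\sigma'$. An isometry is a bijective distance-preserving map. *)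

(* Defs.v *)
From HB Require Import structures.
From mathcomp Require Import all_boot all_order all_algebra.
From mathcomp Require Import ring lra.
From mathcomp Require Import all_classical all_reals all_analysis.

Set Implicit Arguments.
Unset Strict Implicit.
Unset Printing Implicit Defensive.

Import Order.TTheory GRing.Theory Num.Theory.

Local Open Scope classical_set_scope.
Local Open Scope ring_scope.

(* The space [V] together with the Euclidean metric (and the topology) of the
   inner product [dot]; with [theta := idfun] a [{dot V for theta}] is a
   symmetric positive definite bilinear form. *)
Definition euclidean (R : realType) (V : vectType R)
  (dot : {dot V for idfun}) : Type := V.

Section euclidean_metric.
Context (R : realType) (V : vectType R) (dot : {dot V for idfun}).

HB.instance Definition _ := Vector.copy (euclidean dot) V.

Definition euclidean_dist (x y : V) : R := Num.sqrt (dot (x - y) (x - y)).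

Lemma dot_ge0 u : 0 <= dot u u.
Proof.
have [->|/neq0_dnorm_gt0/ltW//] := eqVneq u 0.
by rewrite linear0r.
Qed.

Lemma dotC u v : dot u v = dot v u.
Proof. by rewrite hermC expr0 mul1r. Qed.

Lemma dot_cauchy_schwarz u v : dot u v ^+ 2 <= dot u u * dot v v.
Proof.
have [->|v0] := eqVneq v 0; first by rewrite !linear0r expr0n.
have vv : 0 < dot v v := neq0_dnorm_gt0 _ v0.
have h := dot_ge0 (dot v v *: u - dot u v *: v).
rewrite linearBl !linearBr !linearZl_LR /= !linearZr_LR /= (dotC v u) in h.
rewrite -subr_ge0 -(pmulr_rge0 _ vv); move: h; congr (0 <= _).
by rewrite /GRing.scale /=; ring.
Qed.

Lemma sqrt_dotD u v :
  Num.sqrt (dot (u + v) (u + v)) <= Num.sqrt (dot u u) + Num.sqrt (dot v v).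
Proof.
rewrite -(@ler_pXn2r _ 2) ?nnegrE ?addr_ge0 ?sqrtr_ge0//.
rewrite sqrrD !sqr_sqrtr ?dot_ge0// linearDl !linearDr/= (dotC v u).
have : dot u v <= Num.sqrt (dot u u) * Num.sqrt (dot v v).
  rewrite -sqrtrM ?dot_ge0// (le_trans (ler_norm _))// -sqrtr_sqr.
  by rewrite ler_wsqrtr// dot_cauchy_schwarz.
by rewrite mulr2n; lra.
Qed.

Lemma euclidean_distxx x : euclidean_dist x x = 0.
Proof. by rewrite /euclidean_dist subrr linear0r sqrtr0. Qed.

Lemma euclidean_dist_eq0 x y : euclidean_dist x y = 0 -> x = y.
Proof.
move/eqP; rewrite sqrtr_eq0 => h; apply/eqP; rewrite -subr_eq0.
by apply: contraTT h => uv0; rewrite -ltNge (neq0_dnorm_gt0 _ uv0).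
Qed.

Lemma euclidean_dist_sym x y : euclidean_dist x y = euclidean_dist y x.
Proof. by rewrite /euclidean_dist -opprB hnormN. Qed.

Lemma euclidean_dist_triangle y x z :
  euclidean_dist x z <= euclidean_dist x y + euclidean_dist y z.
Proof.
rewrite /euclidean_dist; have -> : x - z = (x - y) + (y - z) by rewrite subrKA.
exact: sqrt_dotD.
Qed.

HB.instance Definition _ := isMetric.Build R (euclidean dot)
  euclidean_distxx euclidean_dist_eq0 euclidean_dist_sym
  euclidean_dist_triangle.

End euclidean_metric.

(* [closed_ball] of the library is the closure of the open ball, which in a
   general metric space can be smaller than the set below. *)
Definition mclosed_ball (R : realType) (X : metricType R) (x : X) (r : R) :
  set X := [set y | mdist x y <= r].

Definition submetry (R : realType) (Y X : metricType R) (sigma : Y -> X) :=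
  forall (y : Y) (r : R), 0 <= r ->
    sigma @` mclosed_ball y r = mclosed_ball (sigma y) r.

Definition metric_isometry (R : realType) (X X' : metricType R)
  (phi : X -> X') :=
  bijective phi /\ forall x y, mdist (phi x) (phi y) = mdist x y.

Definition saturated (Y X : Type) (sigma : Y -> X) (C : set Y) :=
  exists S : set X, C = sigma @^-1` S.

Definition closed_convex_saturated (R : realType) (V : vectType R)
    (dot : {dot V for idfun}) (X : Type) (sigma : euclidean dot -> X) :
  set (set (euclidean dot)) :=
  [set C | [/\ closed C, convex_set C & saturated sigma C]].

(* Main.v *)
Require Import Defs.
From mathcomp Require Import all_boot all_order all_algebra.
From mathcomp Require Import ring lra.
From mathcomp Require Import all_classical all_reals all_analysis.

(** Convexity of a closed subset of Euclidean space can be read off the metric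
    alone, in a way that submetries respect. Call a subset [S] of a metric
    space escapable if from a point at distance [delta > 0] from [S] one can,
    by moving at most [r], gain essentially [r] in the distance to [S].

    A closed subset of a Euclidean space is convex iff it is escapable
    ([convex_closedP]). If it is convex, run away from an almost nearest point:
    a homothety centred at that point compares the distances at the end of the
    run with those at its start. Conversely, if [C] misses a point [m] of the
    segment between two of its points [a] and [b], then for every [r] there is
    some [y] with [d(y, m) <= r] and with [d(y, a)], [d(y, b)] at least
    [r + delta / 2]; Stewart's theorem in the triangle [a, b, y] forbids this
    for large [r].

    A submetry is 1-Lipschitz, and the distances in its target are realised by
    suitable lifts; hence [S] is escapable iff its inverse image is
    ([escapable_submetry]), and likewise for closedness ([closed_submetry]).
    Composing [sigma] with the isometry [phi] gives a submetry onto [X'], so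
    the two convexity conditions, for [sigma] and for [sigma'], both say that
    [phi @` S] is escapable. *)

Set Implicit Arguments.
Unset Strict Implicit.
Unset Printing Implicit Defensive.

Import Order.TTheory GRing.Theory Num.Theory.

Local Open Scope classical_set_scope.
Local Open Scope ring_scope.

(** In terms of the distance function to [S]: its supremum over the closed ball
    of radius [r] around a point [x] at positive distance from [S] exceeds its
    value at [x] by [r]. The loss from [delta] to [eta] is there because neither
    this supremum nor the distance to [S] needs to be attained. *)
Definition escapable (R : realType) (M : metricType R) (S : set M) :=
  forall (x : M) (r delta eta : R), 0 < r -> 0 < delta -> eta < delta ->
    (forall s, S s -> delta <= mdist x s) ->
    exists2 y, mdist x y <= r & forall s, S s -> eta + r <= mdist y s.

Lemma closed_mdistP (R : realType) (M : metricType R) (S : set M) :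
  closed S <-> forall x, ~ S x ->
    exists2 delta, 0 < delta & forall s, S s -> delta <= mdist x s.
Proof.
split => [clS x nSx|sepS x clx].
  have /nbhs_ballP[d /= d0 dS] : nbhs x (~` S).
    by apply: open_nbhs_nbhs; split => //; exact: closed_openC.
  exists d => // s Ss; rewrite leNgt; apply/negP => xs.
  by apply: (dS s) => //; rewrite ballEmdist.
apply: contrapT => /sepS[d d0 dS].
have [s [Ss]] := clx _ (nbhsx_ballx x d d0).
by rewrite ballEmdist/= ltNge dS.
Qed.

Section Submetry.
Context (R : realType) (Y X : metricType R) (sigma : Y -> X).
Hypothesis hsigma : submetry sigma.

Lemma submetry_lipschitz y z : mdist (sigma y) (sigma z) <= mdist y z.
Proof.
have : mclosed_ball (sigma y) (mdist y z) (sigma z).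
  by rewrite -hsigma ?mdist_ge0//; exists z => //; exact: lexx.
by [].
Qed.

Lemma submetry_lift y x :
  exists2 z, sigma z = x & mdist y z <= mdist (sigma y) x.
Proof.
have : mclosed_ball (sigma y) (mdist (sigma y) x) x by exact: lexx.
by rewrite -hsigma ?mdist_ge0// => -[z yz zx]; exists z.
Qed.

(** The distance from [y] to the inverse image of [S] is the distance from
    [sigma y] to [S], expressed through lower bounds. *)
Lemma submetry_far S y delta :
  (forall s, S s -> delta <= mdist (sigma y) s) <->
  (forall z, (sigma @^-1` S) z -> delta <= mdist y z).
Proof.
split=> far => [z /far|s Ss].
  by move=> /le_trans; apply; exact: submetry_lipschitz.
have [z zs] := submetry_lift y s.
by apply: le_trans; apply: far; rewrite /= zs.
Qed.

Lemma submetry_surj (y0 : Y) x : exists y, sigma y = x.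
Proof. by have [y] := submetry_lift y0 x; exists y. Qed.

Lemma closed_submetry (y0 : Y) S : closed (sigma @^-1` S) <-> closed S.
Proof.
rewrite !closed_mdistP; split=> sep x nSx.
  have [y yx] := submetry_surj y0 x.
  have [|d d0] := sep y; first by rewrite /= yx.
  by move/submetry_far; rewrite yx; exists d.
by have [d d0 /submetry_far] := sep _ nSx; exists d.
Qed.

Lemma escapable_submetry (y0 : Y) S :
  escapable (sigma @^-1` S) <-> escapable S.
Proof.
split=> esc x r d e r0 d0 ed.
  have [y <-] := submetry_surj y0 x.
  move=> /submetry_far/(esc _ _ _ _ r0 d0 ed)[z yz /submetry_far ze].
  exists (sigma z) => //.
  exact: le_trans (submetry_lipschitz _ _) yz.
move=> /submetry_far/(esc _ _ _ _ r0 d0 ed)[w xw we].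
have [z zw xz] := submetry_lift x w.
exists z; first exact: le_trans xz xw.
by apply/submetry_far; rewrite zw.
Qed.

End Submetry.

Lemma submetry_comp_isometry (R : realType) (Y X X' : metricType R)
    (sigma : Y -> X) (phi : X -> X') :
  submetry sigma -> metric_isometry phi -> submetry (phi \o sigma).
Proof.
move=> hs [[psi phiK psiK] dphi] y r r0.
rewrite -image_comp hs//; apply/seteqP; split => [_ [x xr <-]|x' x'r].
  by rewrite /mclosed_ball/= dphi.
by exists (psi x'); rewrite ?psiK// /mclosed_ball/= -dphi psiK.
Qed.

Section Euclidean.
Context (R : realType) (V : vectType R) (dot : {dot V for idfun}).
Local Notation E := (euclidean dot).
Implicit Types (x y a b : E) (C : set E).

Lemma sqr_mdist x y : mdist x y ^+ 2 = dot (x - y) (x - y).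
Proof. by rewrite sqr_sqrtr// dot_ge0. Qed.

Lemma mdist_homothety x y a b (k : R) : 0 <= k -> x - y = k *: (a - b) ->
  mdist x y = k * mdist a b.
Proof.
move=> k0 xy; apply/eqP; rewrite -(eqrXn2 (n := 2)) ?mulr_ge0 ?mdist_ge0//.
rewrite exprMn !sqr_mdist xy linearZl_LR /= linearZr_LR /=.
by rewrite mulrA expr2.
Qed.

Lemma dot_conv (t : R) (u w : V) :
  dot (t *: u + (1 - t) *: w) (t *: u + (1 - t) *: w) =
  t * dot u u + (1 - t) * dot w w - t * (1 - t) * dot (w - u) (w - u).
Proof.
have -> : dot (w - u) (w - u) = dot w w - dot u w *+ 2 + dot u u.
  by rewrite linearBl !linearBr /= (dotC dot w u); ring.
rewrite linearDl !linearDr /= !linearZl_LR /= !linearZr_LR /=.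
rewrite (dotC dot w u) /GRing.scale /=; ring.
Qed.

Lemma stewart (t : R) a b y :
  mdist y (t *: a + (1 - t) *: b) ^+ 2 =
  t * mdist y a ^+ 2 + (1 - t) * mdist y b ^+ 2 - t * (1 - t) * mdist a b ^+ 2.
Proof.
rewrite !sqr_mdist.
have -> : y - (t *: a + (1 - t) *: b) = t *: (y - a) + (1 - t) *: (y - b).
  by rewrite !scalerBr addrACA -opprD -scalerDl [t + _]addrC subrK scale1r.
rewrite [LHS]dot_conv; congr (_ - _ * dot _ _);
  by rewrite opprB [LHS]addrC addrA subrK.
Qed.

(** Let [m = t a + (1 - t) b] be a point of a segment with ends in [C], at
    distance at least [d > 0] from [C]. For a point [y] reached by escaping from
    [m] within distance [r], Stewart's theorem gives
    [r ^ 2 >= (r + d / 2) ^ 2 - t (1 - t) |a - b| ^ 2], which bounds [r d] by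
    [|a - b| ^ 2]. *)
Lemma escapable_convex C : closed C -> escapable C -> convex_set C.
Proof.
move=> /closed_mdistP sepC esc a b t; rewrite !inE => Ca Cb.
apply: contrapT => /sepC[d d0 dC].
pose m : E := t%:num *: (a : E) + (1 - t%:num) *: (b : E).
pose K := mdist (a : E) b ^+ 2.
(* Any [r] with [r * d] greater than [K] works. *)
pose r := (K + 1) / d.
have K0 : 0 <= K by rewrite exprn_ge0 ?mdist_ge0.
have r0 : 0 < r by rewrite divr_gt0// ltr_wpDl.
have [|y my yC] := esc m r d (d / 2) r0 d0 _ dC; first by lra.
have h z : C z -> (d / 2 + r) ^+ 2 <= mdist y z ^+ 2.
  by move=> Cz; rewrite lerXn2r ?nnegrE ?mdist_ge0 ?yC//; lra.
have ha := h _ Ca; have hb := h _ Cb.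
have hm : mdist y m ^+ 2 <= r ^+ 2.
  by rewrite metric_sym lerXn2r ?nnegrE ?mdist_ge0// ltW.
have rd : r * d = K + 1 by rewrite divfK ?gt_eqF.
have t0 : 0 <= t%:num by [].
have t1 : t%:num <= 1 by [].
move: hm; rewrite stewart -/K.
move: (mdist y a ^+ 2) (mdist y b ^+ 2) ha hb t0 t1 => A B ha hb t0 t1.
nra.
Qed.

(** Let [c0] be an almost nearest point of [C] to [x], at distance [rho], and
    let [y] lie at distance [r] beyond [x] on the ray from [c0] through [x]. For
    [c] in [C], the homothety with centre [c0] and ratio [t = rho / (r + rho)]
    maps [y] to [x] and [c] to a point [m] of [C], so that
    [|y - c| = |x - m| / t]. As [|x - m|] is at least the distance of [x] to
    [C], the right-hand side is almost [rho + r] or more. *)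
Lemma convex_escapable C : convex_set C -> escapable C.
Proof.
move=> cvxC x r d e r0 d0 ed dC.
have [[c1 Cc1]|C0] := pselect (exists c, C c); last first.
  exists x => [|c Cc]; first by rewrite mdistxx ltW.
  by case: C0; exists c.
pose D := inf [set mdist x c | c in C].
have hinf : has_inf [set mdist x c | c in C].
  by split; [exists (mdist x c1); exists c1|exists d => _ [c Cc <-]; exact: dC].
have D0 : 0 < D.
  apply: lt_le_trans d0 _; apply: lb_le_inf => [|_ [c Cc <-]]; last exact: dC.
  by exists (mdist x c1); exists c1.
have DC c : C c -> D <= mdist x c.
  by move=> Cc; apply: ge_inf; [case: hinf|exists c].
(* With [rho] the distance of [x] to the almost nearest point, [y] will be at
   distance at least [d + r * (D / rho)] from [C]; so [D / rho] has to exceed a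
   factor [lam < 1] with [r * (1 - lam) <= d - e]. *)
pose lam := r / (r + (d - e)).
have de0 : 0 < r + (d - e) by lra.
have lam0 : 0 < lam by rewrite divr_gt0.
have lam1 : lam < 1 by rewrite ltr_pdivrMr//; lra.
have [|_ [c0 Cc0 <-]] := @inf_adherent _ _ (D / lam - D) _ hinf.
  by rewrite subr_gt0 ltr_pdivlMr// gtr_pMr.
rewrite addrC subrK ltr_pdivlMr// => nearest.
pose rho := mdist x c0.
have rho0 : 0 < rho by apply: lt_le_trans (DC _ Cc0).
exists (x + (r / rho) *: (x - c0)).
  rewrite (@mdist_homothety _ _ c0 x (r / rho)) ?divr_ge0 ?(ltW r0) ?(ltW rho0)//.
    by rewrite (metric_sym c0) divfK ?gt_eqF.
  by rewrite opprD addNKr -scalerN opprB.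
move=> c Cc; pose y : E := x + (r / rho) *: (x - c0).
pose t := rho / (r + rho).
have rr0 : 0 < r + rho by rewrite addr_gt0.
have t0 : 0 <= t by rewrite divr_ge0 ?(ltW rho0) ?(ltW rr0).
have t1 : t <= 1 by rewrite ler_pdivrMr// mul1r lerDr ltW.
pose m : E := t *: c + (1 - t) *: c0.
have Cm : C m.
  by have := cvxC c c0 (Itv01 t0 t1); rewrite !inE; apply.
have xm : mdist x m = t * mdist y c.
  have ty : t *: y = x - (1 - t) *: c0.
    have tk : t * (r / rho) = 1 - t by rewrite /t; field; rewrite !gt_eqF.
    rewrite /y scalerDr scalerA tk scalerBr addrA -scalerDl.
    by rewrite [t + _]addrC subrK scale1r.
  by apply: mdist_homothety => //; rewrite scalerBr ty opprD addrA addrAC.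
have yc : mdist y c * rho = mdist x m * (r + rho).
  by rewrite xm /t; field; rewrite gt_eqF.
rewrite -(ler_pM2r rho0) yc.
have lamE : r * (1 - lam) = lam * (d - e).
  by have : lam * (r + (d - e)) = r by [rewrite divfK ?gt_eqF|]; lra.
have slack : r * (1 - lam) <= d - e by rewrite lamE ler_piMl ?ltW// subr_gt0.
have dm : d * rho <= mdist x m * rho by rewrite ler_pM2r// dC.
have lm : rho * lam * r <= mdist x m * r.
  by rewrite ler_pM2r// ltW// (lt_le_trans nearest)// DC.
have := ler_wpM2r (ltW rho0) slack; lra.
Qed.

Lemma convex_closedP C : closed C -> convex_set C <-> escapable C.
Proof.
by move=> clC; split; [exact: convex_escapable|exact: escapable_convex].
Qed.

End Euclidean.

Theorem corollary2 (R : realType) (V V' : vectType R)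
  (dot : {dot V for idfun}) (dot' : {dot V' for idfun})
  (X X' : metricType R)
  (sigma : euclidean dot -> X) (sigma' : euclidean dot' -> X')
  (phi : X -> X') :
  submetry sigma -> submetry sigma' -> metric_isometry phi ->
  (forall S : set X, closed S ->
     (convex_set (sigma @^-1` S) <-> convex_set (sigma' @^-1` (phi @` S)))) /\
  (exists F : set (euclidean dot) -> set (euclidean dot'),
     (forall S : set X, closed_convex_saturated sigma (sigma @^-1` S) ->
        F (sigma @^-1` S) = sigma' @^-1` (phi @` S)) /\
     set_bij (closed_convex_saturated sigma) (closed_convex_saturated sigma') F).
Proof.
move=> hsigma hsigma' hphi.
have htau := submetry_comp_isometry hsigma hphi.
have [[psi phiK psiK] _] := hphi.
have imphi S : phi @^-1` (phi @` S) = S.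
  by apply/seteqP; split => [x [z Sz /(can_inj phiK) <-]|x Sx]//=; exists x.
have preE S : sigma @^-1` S = (phi \o sigma) @^-1` (phi @` S).
  by rewrite comp_preimage imphi.
have clE S : closed (sigma @^-1` S) <-> closed (sigma' @^-1` (phi @` S)).
  by rewrite preE (closed_submetry htau 0) (closed_submetry hsigma' 0).
have cvxE S : closed (sigma @^-1` S) ->
    convex_set (sigma @^-1` S) <-> convex_set (sigma' @^-1` (phi @` S)).
  move=> clS; rewrite !convex_closedP//; last exact/clE.
  by rewrite preE (escapable_submetry htau 0) (escapable_submetry hsigma' 0).
split=> [S clS|]; first by apply: cvxE; apply/(closed_submetry hsigma 0).
(* The image of [C] under [sigma] recovers the set of which [C] is the inverse
   image, because [sigma] is surjective. *)
pose F C := sigma' @^-1` (phi @` (sigma @` C)).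
have FE S : F (sigma @^-1` S) = sigma' @^-1` (phi @` S).
  rewrite /F image_preimage//; apply/seteqP; split => // x _.
  by have [y yx] := submetry_surj hsigma 0 x; exists y.
exists F; split => [S _|]; first exact: FE.
split.
- move=> C [clS cvxS [S CS]]; subst C; rewrite FE.
  split; [exact/clE|exact/cvxE|by exists (phi @` S)].
- move=> C D /set_mem[_ _ [S ->]] /set_mem[_ _ [T ->]]; rewrite !FE => ST.
  congr (_ @^-1` _); rewrite -[S]imphi -[T]imphi; congr (_ @^-1` _).
  apply/seteqP; split => x' ; have [y <-] := submetry_surj hsigma' 0 x'.
    by rewrite -[_ (sigma' y)]/((sigma' @^-1` _) y) ST.
  by rewrite -[_ (sigma' y)]/((sigma' @^-1` _) y) -ST.
- move=> C' [clT cvxT [T CT]]; subst C'; move: clT cvxT.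
  have -> : T = phi @` (phi @^-1` T).
    by rewrite image_preimage//; apply/seteqP; split=> // x _; exists (psi x).
  move=> clT cvxT; exists (sigma @^-1` (phi @^-1` T)); last by rewrite FE.
  have clS : closed (sigma @^-1` (phi @^-1` T)) by apply/clE.
  by split => //; [apply/cvxE|exists (phi @^-1` T)].
Qed.
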